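(* Let $q$ be a power of a prime $p$, let $n>1$ and $t\ge 2$ be integers. Let $L(x)=\sum_{i=0}^{n-1}a_ix^{q^i}\in \mathbb{F}_{q}[x]$ be a nonzero linearized polynomial and let $l(x)=\sum_{i=0}^{n-1}a_ix^{i}\in\mathbb{F}_q[x]$ be its conventional $q$-associate. Then $L(x)$ is a $t$-nilpotent linearized polynomial over $\mathbb{F}_{q^n}$ if, and only if, $x^n-1$ divides $l(x)^t$ in $\mathbb{F}_q[x]$. In particular, if $n$ is not divisible by $p$, then for any $t\ge 2$ there are no $t$-nilpotent linearized polynomials over $\mathbb{F}_{q^n}$ with coefficients in $\mathbb{F}_q$.
   Context: A polynomial $L(x)\in \mathbb{F}_{q^n}[x]$ is linearized if it has the form $L(x)=\sum_{i=0}^{k}a_ix^{q^i}$ with $a_i\in\mathbb{F}_{q^n}$. $L^{(t)}(x)$ denotes the ordinary polynomial composition of $L(x)$ with itself $t$ times. For an integer $t\ge 2$, $L(x)\in\mathbb{F}_{q^n}[x]$ is a $t$-nilpotent linearized polynomial ($t$-NLP) over $\mathbb{F}_{q^n}$ if $L(x)$ is linearized, $L(x)\not\equiv 0\pmod{x^{q^n}-x}$ and $L^{(t)}(x)\equiv 0\pmod{x^{q^n}-x}$. *)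

(* Defs.v *)
From HB Require Import structures.
From mathcomp Require Import all_boot all_order all_algebra all_field.

Set Implicit Arguments.
Unset Strict Implicit.
Unset Printing Implicit Defensive.

Import GRing.Theory.
Local Open Scope ring_scope.

(* The sum a_0 x + a_1 x^q + ... has k terms, hence q-degree at most k - 1. *)
Definition lin_poly (R : nzRingType) (q k : nat) (a : 'I_k -> R) : {poly R} :=
  \sum_(i < k) a i *: 'X^(q ^ i).

Definition q_associate (R : nzRingType) (k : nat) (a : 'I_k -> R) : {poly R} :=
  \sum_(i < k) a i *: 'X^i.

Definition linearized (R : nzRingType) (q : nat) (f : {poly R}) : Prop :=
  exists (k : nat) (a : 'I_k.+1 -> R), f = lin_poly q a.

(* The t-fold composition f o ... o f, equal to 'X for t = 0. *)
Definition comp_iter (R : nzRingType) (t : nat) (f : {poly R}) : {poly R} :=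
  iter t (fun g => f \Po g) 'X.

(* K is meant to be the field with q ^ n elements, and t to be at least 2;
   neither is enforced here. *)
Definition nilpotent_linearized (K : fieldType) (q n t : nat) (f : {poly K})
    : Prop :=
  [/\ linearized q f,
      ~~ ('X^(q ^ n) - 'X %| f)
    & 'X^(q ^ n) - 'X %| comp_iter t f].

(* Main.v *)
Require Import Defs.
From HB Require Import structures.
From mathcomp Require Import all_boot all_order all_algebra all_field.

Set Implicit Arguments.
Unset Strict Implicit.
Unset Printing Implicit Defensive.

Import GRing.Theory.
Local Open Scope ring_scope.

(* Evaluating linearized polynomials at the points of K makes K a module over
   F[x], with x acting as the q-Frobenius map: the q-associate of a composition
   acts as the product of the q-associates. Both congruences modulo
   x^(q^n) - x say that a polynomial vanishes at all q^n points of K. The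
   annihilator of this module is generated by x^n - 1: the latter kills K, and a
   nonzero remainder of degree < n acts as a nonzero polynomial of degree < q^n,
   which has too few roots. If p does not divide n then x^n - 1 is squarefree,
   so it divides l as soon as it divides a power of l. *)

(** Write u = w * d with d the gcd of u and v. Separability makes w coprime to d, while any common
    divisor of w and v divides d. So w is coprime to v, hence to [v ^+ t], which it divides: w is a
    unit. *)
Lemma separable_dvdp_exp (R : fieldType) (u v : {poly R}) (t : nat) :
  separable_poly u -> u %| v ^+ t -> u %| v.
Proof.
move=> sep_u u_dvd.
have d_max c : (c %| gcdp u v) = (c %| u) && (c %| v) := dvdp_gcd c u v.
move: (gcdp u v) d_max (dvdp_gcdl u v) (dvdp_gcdr u v) => d d_max.
case/dvdpP=> w def_u d_dvd_v.
move: sep_u; rewrite def_u separable_mul => /and3P[_ _ cop_wd].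
have cop_wv : coprimep w v.
  apply/coprimepP => c c_w c_v; move/coprimepP: cop_wd; apply=> //.
  by rewrite d_max c_v andbT def_u dvdp_mulr.
have w_dvd : w %| v ^+ t by apply: dvdp_trans u_dvd; rewrite def_u dvdp_mulr.
have /andP[w1 _] : w %= 1.
  by have /coprimepP := coprimep_expr t cop_wv; apply.
by apply: dvdp_trans d_dvd_v; rewrite -[X in _ %| X]mul1r dvdp_mul.
Qed.

(** The divisor is the product of the distinct factors x - c, for c in K. *)
Lemma dvdp_genPolyP (K : finFieldType) (f : {poly K}) :
  reflect (forall x, f.[x] = 0) ('X^#|K| - 'X %| f).
Proof.
rewrite finField_genPoly; apply: (iffP idP) => [f_dvd x | f0].
  apply/eqP; rewrite -/(root f x) -dvdp_XsubCl; apply: dvdp_trans f_dvd.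
  by rewrite (bigD1 x) //= dvdp_mulr.
rewrite -big_enum; apply: uniq_roots_dvdp; first by apply/allP=> x _; apply/eqP.
by rewrite uniq_rootsE enum_uniq.
Qed.

Lemma horner_comp_iter (R : comNzRingType) (f : {poly R}) (t : nat) (x : R) :
  (comp_iter t f).[x] = iter t (horner f) x.
Proof. by elim: t => [|t IHt]; rewrite /comp_iter /= ?hornerX // horner_comp IHt. Qed.

Section LinearizedPolynomials.

Variables (R : nzRingType) (q : nat).

Lemma coef_lin_poly (k : nat) (a : 'I_k -> R) (i : 'I_k) :
  (1 < q)%N -> (lin_poly q a)`_(q ^ i) = a i.
Proof.
move=> q_gt1; rewrite coef_sum (bigD1 i) //= coefZ coefXn eqxx mulr1.
rewrite big1 ?addr0 // => j ne_ji; rewrite coefZ coefXn eqn_exp2l // eq_sym.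
by rewrite (negPf ne_ji : (j == i :> nat) = false) mulr0.
Qed.

Lemma size_lin_poly (k : nat) (a : 'I_k -> R) :
  (1 < q)%N -> (size (lin_poly q a) <= q ^ k)%N.
Proof.
move=> q_gt1; apply: leq_trans (size_sum _ _ _) _; apply/bigmax_leqP => i _.
by apply: leq_trans (size_scale_leq _ _) _; rewrite size_polyXn ltn_exp2l.
Qed.

Lemma size_q_associate (k : nat) (a : 'I_k -> R) : (size (q_associate a) <= k)%N.
Proof.
apply: leq_trans (size_sum _ _ _) _; apply/bigmax_leqP => i _.
by apply: leq_trans (size_scale_leq _ _) _; rewrite size_polyXn.
Qed.

Lemma coef_q_associate (k : nat) (a : 'I_k -> R) (i : 'I_k) :
  (q_associate a)`_i = a i.
Proof.
rewrite coef_sum (bigD1 i) //= coefZ coefXn eqxx mulr1 big1 ?addr0 // => j ne_ji.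
by rewrite coefZ coefXn eq_sym (negPf ne_ji : (j == i :> nat) = false) mulr0.
Qed.

End LinearizedPolynomials.

Section FrobeniusModule.

Variables (F K : finFieldType) (iota : {rmorphism F -> K}).
Local Notation q := #|F|.

Definition frob_act (l : {poly F}) (x : K) : K :=
  \sum_(i < size l) iota l`_i * x ^+ (q ^ i).

Lemma card_gt1 : (1 < q)%N.
Proof. by have := finNzRing_gt1 F. Qed.

(** Coefficients beyond the size are 0, so polynomials of different sizes can be handled over one
    common range. *)
Lemma frob_act_wide (k : nat) (l : {poly F}) (x : K) :
  (size l <= k)%N -> frob_act l x = \sum_(i < k) iota l`_i * x ^+ (q ^ i).
Proof.
move=> le_lk; rewrite /frob_act (big_ord_widen k (fun i => iota l`_i * x ^+ (q ^ i)) le_lk) [LHS]big_mkcond.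
apply: eq_bigr => i _ /=; case: ltnP => // /(nth_default 0)->.
by rewrite rmorph0 mul0r.
Qed.

Lemma frob_actD (l m : {poly F}) (x : K) :
  frob_act (l + m) x = frob_act l x + frob_act m x.
Proof.
pose k := maxn (size l) (size m).
rewrite !(@frob_act_wide k) ?leq_maxl ?leq_maxr ?size_polyD // -big_split /=.
by apply: eq_bigr => i _; rewrite coefD rmorphD mulrDl.
Qed.

Lemma frob_actC (c : F) (x : K) : frob_act c%:P x = iota c * x.
Proof.
by rewrite (frob_act_wide _ (size_polyC_leq1 c)) big_ord1 coefC.
Qed.

Lemma frob_actCM (c : F) (m : {poly F}) (x : K) :
  frob_act (c%:P * m) x = iota c * frob_act m x.
Proof.
rewrite mul_polyC (frob_act_wide _ (size_scale_leq c m)) mulr_sumr.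
by apply: eq_bigr => i _; rewrite coefZ rmorphM mulrA.
Qed.

(** q is a power of the characteristic of F, which K shares through [iota]. *)
Lemma expD_card (x y : K) : (x + y) ^+ q = x ^+ q + y ^+ q.
Proof.
have [p p_pr pcharF] := finPcharP F; apply: exprDn_pchar.
have pcharK : p \in [pchar K] by rewrite (fmorph_pchar iota).
rewrite (eq_pnat _ (pcharf_eq pcharK)) -cardsT.
exact: (pprimeChar_pgroup pcharF).
Qed.

(** The coefficients come from F, so each is its own q-th power; the multiplicativity of the action
    rests on this. *)
Lemma frob_act_exp (m : {poly F}) (x : K) :
  frob_act m (x ^+ q) = frob_act m x ^+ q.
Proof.
have expr0q : 0 ^+ q = 0 :> K by rewrite expr0n eqn0Ngt (ltnW card_gt1).
rewrite /frob_act (big_morph (fun y => y ^+ q) expD_card expr0q).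
apply: eq_bigr => i _.
by rewrite exprMn -rmorphXn expf_card -!exprM mulnC.
Qed.

Lemma frob_actMX (l : {poly F}) (x : K) :
  frob_act (l * 'X) x = frob_act l (x ^+ q).
Proof.
have size_lX : (size (l * 'X)%R <= (size l).+1)%N.
  by have := size_polyMleq l 'X; rewrite size_polyX addn2.
rewrite (frob_act_wide _ size_lX).
rewrite big_ord_recl coefMX /= rmorph0 mul0r add0r; apply: eq_bigr => i _.
by rewrite coefMX /= expnS exprM.
Qed.

Lemma frob_actM (l m : {poly F}) (x : K) :
  frob_act (l * m) x = frob_act l (frob_act m x).
Proof.
elim/poly_ind: l m x => [|l c IHl] m x.
  by rewrite mul0r /frob_act size_poly0 !big_ord0.
rewrite mulrDl !frob_actD frob_actCM frob_actC -mulrA IHl.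
by rewrite ['X * m]mulrC !frob_actMX frob_act_exp.
Qed.

Lemma frob_actX (l : {poly F}) (t : nat) (x : K) :
  frob_act (l ^+ t) x = iter t (frob_act l) x.
Proof.
elim: t => [|t IHt]; last by rewrite exprS frob_actM IHt.
by rewrite expr0 frob_actC rmorph1 mul1r.
Qed.

(** Leaving [l] general serves both the [q_associate] and the remainder [r] in [frob_act_eq0P]. *)
Lemma horner_lin_poly (k : nat) (a : 'I_k -> F) (l : {poly F}) (x : K) :
  (size l <= k)%N -> (forall i : 'I_k, l`_i = a i) ->
  (map_poly iota (lin_poly q a)).[x] = frob_act l x.
Proof.
move=> le_lk l_a; rewrite (frob_act_wide _ le_lk) rmorph_sum horner_sum.
apply: eq_bigr => i _.
by rewrite /= map_polyZ map_polyXn hornerZ hornerXn l_a.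
Qed.

Variable n : nat.
Hypotheses (n_gt0 : (0 < n)%N) (cardK : #|K| = (q ^ n)%N).

Lemma frob_act_eq0P (l : {poly F}) :
  reflect (forall x, frob_act l x = 0) ('X^n - 1 %| l).
Proof.
have act_Xn x : frob_act ('X^n - 1) x = 0.
  rewrite -[- 1]polyCN frob_actD frob_actC rmorphN1 mulN1r.
  have -> : frob_act 'X^n x = x ^+ (q ^ n).
    rewrite (@frob_act_wide n.+1) ?size_polyXn // big_ord_recr /= coefXn eqxx.
    rewrite rmorph1 mul1r big1 ?add0r // => i _.
    by rewrite coefXn ltn_eqF // rmorph0 mul0r.
  by rewrite -cardK expf_card subrr.
have act_mul w x : frob_act (w * ('X^n - 1)) x = 0.
  rewrite frob_actM act_Xn /frob_act big1 // => i _.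
  by rewrite expr0n expn_eq0 eqn0Ngt (ltnW card_gt1) mulr0.
apply: (iffP idP) => [/dvdpP[w ->] // | act0]; apply/modp_eq0P.
set r := _ %% _; have size_r : (size r <= n)%N.
  by rewrite -ltnS -(size_XnsubC (1 : F) n_gt0) polyC1 ltn_modp -size_poly_eq0 -polyC1 size_XnsubC.
have act_r x : frob_act r x = 0.
  by have := act0 x; rewrite {1}(divp_eq l ('X^n - 1)) frob_actD act_mul add0r.
pose f := lin_poly q (fun i : 'I_n => r`_i).
have f0 : map_poly iota f = 0.
  (* A nonzero [f] would have all q^n elements of K as roots, although its size is at most q^n, that
     is, its degree is below q^n. *)
  apply: contraTeq (size_lin_poly (fun i : 'I_n => r`_i) card_gt1) => f_neq0.
  rewrite -ltnNge -cardK -(size_map_poly iota) cardE.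
  apply: max_poly_roots; rewrite ?enum_uniq //.
  by apply/allP=> x _; rewrite /root (horner_lin_poly _ size_r) // act_r.
apply/polyP=> i; rewrite coef0; have [lt_in | le_ni] := ltnP i n; last first.
  by rewrite nth_default // (leq_trans size_r).
(* As [iota] is injective, [f] itself is 0, and its coefficient at q^i is that of [r] at i. *)
have <- := coef_lin_poly (fun i : 'I_n => r`_i) (Ordinal lt_in) card_gt1.
by move/eqP: f0; rewrite map_poly_eq0 -/f => /eqP->; rewrite coef0.
Qed.

Lemma dvdp_frob_act (f : {poly K}) (l : {poly F}) :
  (forall x, f.[x] = frob_act l x) ->
  ('X^(q ^ n) - 'X %| f) = ('X^n - 1 %| l).
Proof.
move=> f_l; rewrite -cardK.
by apply/dvdp_genPolyP/frob_act_eq0P => f0 x; rewrite ?f_l // -f_l.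
Qed.

Lemma dvdp_comp_iter_frob_act (f : {poly K}) (l : {poly F}) (t : nat) :
  (forall x, f.[x] = frob_act l x) ->
  ('X^(q ^ n) - 'X %| comp_iter t f) = ('X^n - 1 %| l ^+ t).
Proof.
move=> f_l; apply: dvdp_frob_act => x.
by rewrite horner_comp_iter frob_actX; apply: eq_iter.
Qed.

(** The coefficients supplied by [linearized] lie in K only, but they are images of coefficients of
    [M] at the exponents q^i, from which [l] is built. *)
Lemma linearized_frob_act (M : {poly F}) :
  linearized q (map_poly iota M) ->
  exists l : {poly F}, forall x, (map_poly iota M).[x] = frob_act l x.
Proof.
case=> k [b def_M]; exists (\poly_(i < k.+1) M`_(q ^ i)) => x.
rewrite (frob_act_wide _ (size_poly _ _)) def_M horner_sum.
apply: eq_bigr => i _; rewrite hornerZ hornerXn coef_poly ltn_ord -coef_map def_M.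
by rewrite (coef_lin_poly _ _ card_gt1).
Qed.

End FrobeniusModule.

Theorem theorem2 (p e q n : nat) (F K : finFieldType) (iota : {rmorphism F -> K})
    (hp : prime p) (he : (0 < e)%N) (hq : q = (p ^ e)%N) (hn : (1 < n)%N)
    (hF : #|F| = q) (hK : #|K| = (q ^ n)%N) :
  (forall (t : nat) (a : 'I_n -> F),
      (2 <= t)%N -> lin_poly q a != 0 ->
      (nilpotent_linearized q n t (map_poly iota (lin_poly q a))
       <-> 'X^n - 1 %| q_associate a ^+ t))
  /\ (~~ (p %| n)%N ->
      forall t : nat, (2 <= t)%N ->
      ~ exists M : {poly F}, nilpotent_linearized q n t (map_poly iota M)).
Proof.
have pcharF : p \in [pchar F].
  by apply: (@card_finPcharP _ p e) => //; rewrite hF hq.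
clear he hq; subst q; have n_gt0 := ltnW hn; split=> [t a _ a_neq0 | p'n t _ [M]].
  have act_a x :
      (map_poly iota (lin_poly #|F| a)).[x] = frob_act iota (q_associate a) x.
    by apply: horner_lin_poly (size_q_associate a) (coef_q_associate a).
  have dvd_t := dvdp_comp_iter_frob_act n_gt0 hK t act_a.
  split=> [[_ _] | a_nil]; first by rewrite dvd_t.
  split; rewrite ?dvd_t //.
    (* [linearized] asks for a successor number of terms, so n is replaced by k + 1. *)
    case: n a {a_neq0 act_a dvd_t a_nil} n_gt0 {hn hK} => // k a _.
    exists k, (iota \o a); rewrite rmorph_sum; apply: eq_bigr => i _.
    by rewrite /= map_polyZ map_polyXn.
  rewrite (dvdp_frob_act n_gt0 hK act_a); apply: contra a_neq0 => dvd_a.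
  have a0 : q_associate a = 0.
    (* A nonzero multiple of x^n - 1 has size above n, but [q_associate a] has size at most n. *)
    apply: contraTeq dvd_a => a_neq0; apply: contraL (size_q_associate a).
    by move/(dvdp_leq a_neq0); rewrite -polyC1 size_XnsubC // -ltnNge.
  by apply/eqP/big1 => i _; rewrite -coef_q_associate a0 coef0 scale0r.
case=> /linearized_frob_act[l act_l].
rewrite (dvdp_frob_act n_gt0 hK act_l) (dvdp_comp_iter_frob_act n_gt0 hK t act_l).
move=> /negP ndvd_l dvd_lt; apply/ndvd_l/separable_dvdp_exp/dvd_lt.
(* In characteristic p, the integer n is nonzero in F exactly when p does not divide it. *)
by apply: separable_Xn_sub_1; rewrite -(dvdn_pcharf pcharF).
Qed.
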